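(* Let $d$ be a positive integer and $0\le k\le n$ integers. Then $$\det\left((-t)^{\binom{i-j}{2}}\binom{n}{k-j+i}_{F(s,t)}\right)_{i,j=0}^{d-1}=\left\langle \begin{matrix} n\\ k\end{matrix}\right\rangle_{d,F(s,t)}.$$ In particular $\left\langle \begin{matrix} n\\ k\end{matrix}\right\rangle_{d,F(s,t)}$ is a polynomial in $s,t$ with integer coefficients.
   Context: $s,t$ are indeterminates. Fibonacci polynomials: $F_0(s,t)=0$, $F_1(s,t)=1$, $F_n(s,t)=sF_{n-1}(s,t)+tF_{n-2}(s,t)$. Fibonomials: $\binom{m}{k}_{F(s,t)}=\prod_{j=0}^{k-1}\frac{F_{m-j}(s,t)}{F_{k-j}(s,t)}$ for $0\le k\le m$, and $0$ if $k<0$ or $k>m$. Hoggatt coefficients: for $0\le k\le n$, $\left\langle \begin{matrix} n\\ k\end{matrix}\right\rangle_{d,F(s,t)}=\prod_{j=0}^{k-1}\frac{\binom{n-j+d-1}{d}_{F(s,t)}}{\binom{k-j+d-1}{d}_{F(s,t)}}$ (a priori a rational function of $s,t$). For any integer $m$, $\binom{m}{2}=m(m-1)/2$. *)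

(* Defs.v *)
From HB Require Import structures.
From mathcomp Require Import all_boot all_order all_algebra.
From mathcomp Require Import mpoly.

Set Implicit Arguments.
Unset Strict Implicit.
Unset Printing Implicit Defensive.

Import Order.TTheory GRing.Theory Num.Theory.

Local Open Scope ring_scope.

Definition Zst := {mpoly int[2]}.
Definition Qst := {fraction Zst}.

Definition s : Zst := 'X_(0 : 'I_2).
Definition t : Zst := 'X_(1 : 'I_2).

Fixpoint fibpoly (n : nat) : Zst :=
  match n with
  | 0 => 0
  | n1.+1 => match n1 with
             | 0 => 1
             | n2.+1 => s * fibpoly n1 + t * fibpoly n2
             end
  end.

(* Under the guard, the truncated subtractions on nat are exact. *)
Definition fibonomial (m : nat) (k : int) : Qst :=
  if 0 <= k <= m%:Z then
    \prod_(j < `|k|%N)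
      (tofrac (fibpoly (m - j)%N) / tofrac (fibpoly (`|k| - j)%N))
  else 0.

(* Meaningful for k <= n and 0 < d, where the truncated subtractions on nat
   are exact. *)
Definition hoggatt (d n k : nat) : Qst :=
  \prod_(j < k)
    (fibonomial (n - j + d - 1)%N d%:Z / fibonomial (k - j + d - 1)%N d%:Z).

(* The division is exact, and the value is nonnegative also for m < 0. *)
Definition binz2 (m : int) : int := ((m * (m - 1)) %/ 2)%Z.

(* Main.v *)
(* Write u = -t and let D(d, k) be the determinant.  Deleting outer rows and
   columns from its matrix leaves, up to powers of u, matrices of the same kind,
   so that Desnanot-Jacobi gives
     D(d+2, k) D(d, k) = D(d+1, k)^2 - u^(d+1) D(d+1, k+1) D(d+1, k-1).
   The Hoggatt coefficients telescope to the MacMahon-type product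
     G(a+b+d) G(a) G(b) G(d) / (G(a+d) G(b+d) G(a+b)),  a = n-k, b = k,
   where G is the superfactorial of the Fibonacci polynomials; for it the same
   recurrence reduces to Vajda's identity
     F(a+d) F(b+d) - u^d F(a) F(b) = F(a+b+d) F(d).
   As these products do not vanish, induction on d identifies both sides, and
   polynomiality of the determinant follows from that of the fibonomials. *)

Require Import Defs.
From mathcomp Require Import all_boot all_order all_algebra all_fingroup.
From mathcomp Require Import ring zify mpoly.
Import Order.TTheory GRing.Theory Num.Theory.
Local Open Scope ring_scope.

(** * Schur complements and the Desnanot-Jacobi identity *)

Lemma det_block_schur (K : fieldType) m n (A : 'M[K]_m) (B : 'M_(m, n)) (C : 'M_(n, m)) (E : 'M_n) :
  E \in unitmx ->
  \det (block_mx A B C E) = \det E * \det (A - B *m invmx E *m C).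
Proof.
move=> uE.
have -> : block_mx A B C E =
    block_mx (A - B *m invmx E *m C) B 0 E *m block_mx 1%:M 0 (invmx E *m C) 1%:M.
  rewrite mulmx_block !mulmx1 !mulmx0 !add0r.
  by rewrite mulmxA subrK mulKVmx.
by rewrite det_mulmx det_ublock det_lblock !det1 !mulr1 mulrC.
Qed.

Lemma det_mx2 (R : comNzRingType) (A : 'M[R]_2) : \det A = A 0 0 * A 1 1 - A 0 1 * A 1 0.
Proof.
rewrite (expand_det_row _ 0) !big_ord_recl big_ord0 addr0 /cofactor !det_mx11 !mxE /=.
rewrite /bump /= !add0n !addn0 expr0 expr1 !mul1r mulN1r mulrN.
by congr (_ * A _ _ - A _ _ * A _ _); apply/val_inj.
Qed.

Lemma det_perm_rc (R : comNzRingType) n (s s' : 'S_n) (A : 'M[R]_n) :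
  \det (\matrix_(i, j) A (s i) (s' j)) = (-1) ^+ s * (-1) ^+ s' * \det A.
Proof.
have -> : \matrix_(i, j) A (s i) (s' j) = row_perm s (col_perm s' A).
  by apply/matrixP => i j; rewrite !mxE.
rewrite row_permE col_permE !det_mulmx !det_perm odd_permV.
by rewrite [\det A * _]mulrC mulrA.
Qed.

Section DesnanotJacobi.
Variables (K : fieldType) (a : nat -> nat -> K) (m : nat).

Let minor n r c := \det (\matrix_(i < n, j < n) a (r + i)%N (c + j)%N).

Let E := \matrix_(i < m, j < m) a (1 + i)%N (1 + j)%N.

Let schur r c : K :=
  a r c - ((\row_j a r (1 + j)%N) *m invmx E *m (\col_i a (1 + i)%N c)) 0 0.

Let border r c : 'M[K]_m.+1 :=
  block_mx (a r c)%:M (\row_j a r (1 + j)%N) (\col_i a (1 + i)%N c) E.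

Let det_border r c : E \in unitmx -> \det (border r c) = \det E * schur r c.
Proof.
move=> uE; rewrite [LHS](det_block_schur _ 1 m) // det_mx11 !mxE eqxx mulr1n.
by rewrite /schur [in RHS]mxE.
Qed.

(* The four corner minors have the interior block in different corners; this
   cyclic shift moves it to the lower right one, and its sign cancels. *)
Let rot : 'S_m.+1 := perm (@ord_pred_inj m.+1).

Let rot0 : rot 0 = m :> nat.
Proof. by rewrite permE /= modn_small. Qed.

Let rotS (i : 'I_m) : rot (lift 0 i) = i :> nat.
Proof.
by rewrite permE [LHS]/= add0n modnDr modn_small // ltnS ltnW.
Qed.

(** For [p] false the rows 0, ..., m already start with the outer row 0. For [p] true the outer row
    m + 1 comes last, and [rot] brings it to the front. The same applies to columns and [q]. *)
Let minor_border (p q : bool) :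
  minor m.+1 p q =
  (-1) ^+ (p && rot) * (-1) ^+ (q && rot)
    * \det (border (if p then m.+1 else 0%N) (if q then m.+1 else 0%N)).
Proof.
pose w (b : bool) : 'S_m.+1 := if b then rot else 1%g.
have ww b : (b && rot) = w b :> bool by case: b; rewrite //= odd_perm1.
have w0 (b : bool) : (b + w b ord0)%N = (if b then m.+1 else 0)%N.
  by case: b; rewrite /= ?rot0 ?perm1.
have wS (b : bool) (i : 'I_m) : (b + w b (lift ord0 i))%N = (1 + i)%N.
  by case: b; rewrite /= ?rotS // perm1.
have -> : border (if p then m.+1 else 0%N) (if q then m.+1 else 0%N) =
   \matrix_(i, j) (\matrix_(i < m.+1, j < m.+1) a (p + i)%N (q + j)%N) (w p i) (w q j).
  apply/matrixP => i j; rewrite [RHS]mxE [RHS]mxE.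
  rewrite -(@splitK 1 m i) -(@splitK 1 m j).
  rewrite /border; case: (@split 1 m i) => i'; case: (@split 1 m j) => j' /=.
  - rewrite [i']ord1 [j']ord1 [LHS]block_mxEul mxE eqxx mulr1n.
    by rewrite -!w0; congr (a (_ + w _ _) (_ + w _ _)); apply/val_inj.
  - rewrite [i']ord1 [LHS]block_mxEur mxE -w0 -(wS q).
    by congr (a (_ + w _ _) (_ + w _ _)); apply/val_inj.
  - rewrite [j']ord1 [LHS]block_mxEdl mxE -w0 -(wS p).
    by congr (a (_ + w _ _) (_ + w _ _)); apply/val_inj.
  - rewrite [LHS]block_mxEdr mxE -(wS p) -(wS q).
    by congr (a (_ + w _ _) (_ + w _ _)); apply/val_inj.
rewrite det_perm_rc !ww /minor.
by case: (w p : bool); case: (w q : bool); rewrite ?expr0 ?expr1; ring.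
Qed.

(** In the order 0, m + 1, 1, ..., m the Schur complement of [E] is the 2 by 2 matrix of [schur]
    values at the corners. Rows and columns undergo the same permutation, so its sign squares
    away. *)
Let minor_full : E \in unitmx -> minor m.+2 0 0 =
  \det E * (schur 0 0 * schur m.+1 m.+1 - schur 0 m.+1 * schur m.+1 0).
Proof.
move=> uE; pose z (i : 'I_2) : nat := if i == 0 then 0%N else m.+1.
pose w : 'S_m.+2 := lift_perm 0 0 rot.
have w0 (i : 'I_2) : w (lshift m i : 'I_m.+2) = z i :> nat.
  rewrite /w; case: (unliftP 0 i) => [k|] ->.
    have -> : (lshift m (lift 0 k) : 'I_m.+2) = lift ord0 ord0.
      by apply/val_inj; rewrite [k]ord1.
    by rewrite lift_perm_lift [LHS]/= rot0.
  have -> : (lshift m (0 : 'I_2) : 'I_m.+2) = ord0 by apply/val_inj.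
  by rewrite lift_perm_id.
have wS (i : 'I_m) : w (rshift 2 i : 'I_m.+2) = (1 + i)%N :> nat.
  rewrite /w; have -> : (rshift 2 i : 'I_m.+2) = lift ord0 (lift ord0 i) by apply/val_inj.
  by rewrite lift_perm_lift [LHS]/= rotS.
have -> : minor m.+2 0 0 = \det (block_mx (\matrix_(i < 2, j < 2) a (z i) (z j))
  (\matrix_(i < 2, j < m) a (z i) (1 + j)%N) (\matrix_(i < m, j < 2) a (1 + i)%N (z j)) E).
  have -> : block_mx (\matrix_(i < 2, j < 2) a (z i) (z j))
      (\matrix_(i < 2, j < m) a (z i) (1 + j)%N) (\matrix_(i < m, j < 2) a (1 + i)%N (z j)) E
      = \matrix_(i, j) (\matrix_(i < m.+2, j < m.+2) a (0 + i)%N (0 + j)%N) (w i) (w j).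
    apply/matrixP => i j; rewrite [RHS]mxE [RHS]mxE !add0n.
    rewrite -(@splitK 2 m i) -(@splitK 2 m j).
    case: (@split 2 m i) => i'; case: (@split 2 m j) => j' /=.
    - by rewrite [LHS]block_mxEul mxE !w0.
    - by rewrite [LHS]block_mxEur mxE w0 wS.
    - by rewrite [LHS]block_mxEdl mxE w0 wS.
    - by rewrite [LHS]block_mxEdr mxE !wS.
  rewrite det_perm_rc; case: (w : bool); rewrite ?expr0 ?expr1 /minor; ring.
rewrite det_block_schur // det_mx2; congr (_ * _).
suff S (i j : 'I_2) : ((\matrix_(i, j) a (z i) (z j)) -
    (\matrix_(i < 2, j < m) a (z i) (1 + j)%N) *m invmx E *m
    \matrix_(i < m, j < 2) a (1 + i)%N (z j)) i j = schur (z i) (z j) by rewrite !S.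
rewrite /schur !mxE; congr (_ - _); apply: eq_bigr => k _; rewrite !mxE; congr (_ * _).
by apply: eq_bigr => l _; rewrite !mxE.
Qed.

(** Every minor is [\det E] times an expression in [schur]. What remains is the expansion of a 2 by
    2 determinant. *)
Lemma desnanot_jacobi :
  minor m 1 1 != 0 ->
  minor m.+2 0 0 * minor m 1 1 =
  minor m.+1 0 0 * minor m.+1 1 1 - minor m.+1 0 1 * minor m.+1 1 0.
Proof.
move=> nz; have uE : E \in unitmx by rewrite unitmxE unitfE.
rewrite minor_full //.
rewrite (minor_border false false) (minor_border true true).
rewrite (minor_border false true) (minor_border true false) /= !det_border //.
rewrite -/E /minor -/E; case: (rot : bool); rewrite ?expr0 ?expr1; ring.
Qed.
End DesnanotJacobi.

(** * The exponents, and positivity at s = t = 1 *)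

Lemma binz2D1 (m : int) : binz2 (m + 1) = binz2 m + m.
Proof.
rewrite /binz2 (_ : (m + 1) * (m + 1 - 1) = m * 2 + m * (m - 1)); last by ring.
by rewrite divzMDl // addrC.
Qed.

Lemma binz2_ge0 (m : int) : 0 <= binz2 m.
Proof. by rewrite /binz2 divz_ge0 //; nia. Qed.

(** The values at s = t = 1 are the Fibonacci numbers; their positivity yields [fibQ_neq0], hence
    all later divisions. *)
Lemma fibpoly_at1_gt0 n : 0 < (fibpoly n.+1).@[fun=> 1].
Proof.
suff: 0 <= (fibpoly n).@[fun=> 1] /\ 0 < (fibpoly n.+1).@[fun=> 1] by case.
elim: n => [|n [H0 H1]]; first by rewrite /= meval0 meval1.
split; first exact: ltW.
rewrite [fibpoly n.+2]/= mevalD !mevalM !mevalXU.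
by rewrite !mul1r ltr_wpDr.
Qed.

(** * Fibonacci identities over a field *)

Section FibonacciField.
Variables (K : fieldType) (s t : K) (f : nat -> K).
Hypotheses (f0 : f 0 = 0) (f1 : f 1 = 1).
Hypothesis fS : forall n, f n.+2 = s * f n.+1 + t * f n.
Hypothesis f_neq0 : forall n, f n.+1 != 0.

Lemma fib_add m n : f (m + n).+1 = f m.+1 * f n.+1 + t * (f m * f n).
Proof.
elim: m n => [|m IH] n; first by rewrite add0n f0 f1; ring.
by rewrite addSnnS IH !fS; ring.
Qed.

(** The left side is a Casorati determinant of two solutions of the recurrence, so each step in [c]
    multiplies it by -t. *)
Lemma fib_docagne a c : f (a + c).+1 * f c - f (a + c) * f c.+1 = - (- t) ^+ c * f a.
Proof.
elim: c => [|c IH]; first by rewrite addn0 f0 f1; ring.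
rewrite addnS !fS exprS.
transitivity (- t * (- (- t) ^+ c * f a)); last by ring.
by rewrite -IH; ring.
Qed.

(** For positive [c], the addition formula applied to both sides leaves a difference that is t f(b)
    times d'Ocagne's identity. *)
Lemma fib_vajda a b c :
  f (a + c) * f (b + c) - (- t) ^+ c * (f a * f b) = f (a + b + c) * f c.
Proof.
case: c => [|c]; first by rewrite !addn0 f0; ring.
rewrite !addnS addnAC (fib_add b c) (fib_add (a + c) b) exprS.
transitivity (f (a + c).+1 * f b.+1 * f c.+1 + t * f (a + c) * f b * f c.+1
  + t * f b * (f (a + c).+1 * f c - f (a + c) * f c.+1 + (- t) ^+ c * f a)); first by ring.
by rewrite fib_docagne; ring.
Qed.


(** * Toeplitz determinants and their recurrence *)

Lemma det_diag_conj (v : nat -> K) x n (A : 'M[K]_n) : (forall i, v i != 0) ->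
  \det (\matrix_(i, j) (x * v i / v j * A i j)) = x ^+ n * \det A.
Proof.
move=> v0.
have -> : \matrix_(i, j) (x * v i / v j * A i j) =
    diag_mx (\row_i (x * v i)) *m A *m diag_mx (\row_i (v i)^-1).
  apply/matrixP => i j; rewrite mul_mx_diag mul_diag_mx !mxE; ring.
rewrite !det_mulmx !det_diag mulrAC -big_split /=; congr (_ * _).
rewrite -[n in RHS]card_ord -prodr_const; apply: eq_bigr => i _.
by rewrite !mxE mulfK.
Qed.

(** [k] is an integer because the recurrence also reaches -1 and n + 1, just outside the range of
    the coefficients. *)
Definition toeplitz_det (u : K) (c : int -> K) d (k : int) : K :=
  \det (\matrix_(i < d, j < d) (u ^ binz2 (i%:Z - j%:Z) * c (k - j%:Z + i%:Z))).

Lemma toeplitz_det_rec u c d k : u != 0 -> toeplitz_det u c d k != 0 ->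
  toeplitz_det u c d.+2 k * toeplitz_det u c d k =
  toeplitz_det u c d.+1 k ^+ 2
  - u ^+ d.+1 * (toeplitz_det u c d.+1 (k + 1) * toeplitz_det u c d.+1 (k - 1)).
Proof.
move=> u0 D0; pose a i j := u ^ binz2 (i%:Z - j%:Z) * c (k - j%:Z + i%:Z).
have a11 n : \matrix_(i < n, j < n) a (1 + i)%N (1 + j)%N =
   \matrix_(i < n, j < n) a (0 + i)%N (0 + j)%N.
  apply/matrixP => i j; rewrite !mxE /a; congr (_ ^ binz2 _ * c _); lia.
have a10 n : \det (\matrix_(i < n, j < n) a (1 + i)%N (0 + j)%N) = toeplitz_det u c n (k + 1).
  rewrite -[RHS]mul1r -(expr1n _ n).
  (* A row shift adds i - j to the exponent [binz2 (i - j)]: a pure diagonal conjugation. *)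
  rewrite -(det_diag_conj (fun i => u ^+ i)) => [|i]; last by rewrite expf_neq0.
  congr (\det _); apply/matrixP => i j; rewrite !mxE /a add0n PoszD.
  rewrite (_ : 1%:Z + i%:Z - j%:Z = i%:Z - j%:Z + 1) ?binz2D1; last by ring.
  rewrite !expfzDr // mul1r.
  rewrite (_ : k - j%:Z + (1%:Z + i%:Z) = k + 1 - j%:Z + i%:Z); last by ring.
  by rewrite -exprnN -!exprnP; ring.
have a01 n : \det (\matrix_(i < n, j < n) a (0 + i)%N (1 + j)%N) =
    u ^+ n * toeplitz_det u c n (k - 1).
  (* A column shift adds 1 - (i - j) to the exponent: a conjugation together with one factor [u] per
     row. *)
  rewrite -(det_diag_conj (fun i => u ^- i)) => [|i]; last by rewrite invr_eq0 expf_neq0.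
  congr (\det _); apply/matrixP => i j; rewrite !mxE /a add0n PoszD.
  rewrite [in RHS](_ : i%:Z - j%:Z = i%:Z - (1%:Z + j%:Z) + 1) ?binz2D1; last by ring.
  rewrite !expfzDr // invrK.
  rewrite (_ : k - (1%:Z + j%:Z) + i%:Z = k - 1 - j%:Z + i%:Z); last by ring.
  rewrite opprD expfzDr // -!exprnN -!exprnP.
  by field; rewrite u0 !expf_neq0.
have /= := @desnanot_jacobi K a d.
rewrite !a11 a10 a01 => DJ.
by rewrite [LHS]DJ // /toeplitz_det; ring.
Qed.

(** At k = -1 the matrix is strictly lower triangular; at k = n + 1, below, it is strictly upper
    triangular. This closes the recurrence at both ends. *)
Lemma toeplitz_det_low u c d : (forall k : int, k < 0 -> c k = 0) -> toeplitz_det u c d.+1 (-1) = 0.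
Proof.
move=> c0; have z (i j : 'I_d.+1) : (i <= j)%N -> c (-1 - j%:Z + i%:Z) = 0.
  by move=> ij; apply: c0; lia.
rewrite /toeplitz_det det_trig.
  by rewrite big_ord_recl mxE z // mulr0 mul0r.
by apply/is_trig_mxP => i j ij; rewrite mxE z ?mulr0 // ltnW.
Qed.

Lemma toeplitz_det_high u c d (n : int) :
  (forall k : int, n < k -> c k = 0) -> toeplitz_det u c d.+1 (n + 1) = 0.
Proof.
move=> c0; have z (i j : 'I_d.+1) : (j <= i)%N -> c (n + 1 - j%:Z + i%:Z) = 0.
  by move=> ij; apply: c0; lia.
rewrite /toeplitz_det -det_tr det_trig.
  by rewrite big_ord_recl !mxE z // mulr0 mul0r.
by apply/is_trig_mxP => i j ij; rewrite !mxE z ?mulr0 // ltnW.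
Qed.

(** * Fibonacci superfactorials and the MacMahon-type product *)

Definition fibfact n : K := \prod_(i < n) f i.+1.
(** The last factor is the factorial of n - 1, the indexing (Barnes G at n + 1) in which MacMahon's
    box formula is stated. *)
Definition fibsuperfact n : K := \prod_(i < n) fibfact i.

Lemma fibfact0 : fibfact 0 = 1.
Proof. exact: big_ord0. Qed.

Lemma fibsuperfact0 : fibsuperfact 0 = 1.
Proof. exact: big_ord0. Qed.

Lemma fibfactS n : fibfact n.+1 = fibfact n * f n.+1.
Proof. exact: big_ord_recr. Qed.

Lemma fibsuperfactS n : fibsuperfact n.+1 = fibsuperfact n * fibfact n.
Proof. exact: big_ord_recr. Qed.

Lemma fibfact_neq0 n : fibfact n != 0.
Proof. by apply/prodf_neq0 => i _. Qed.

Lemma fibsuperfact_neq0 n : fibsuperfact n != 0.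
Proof. by apply/prodf_neq0 => i _; apply: fibfact_neq0. Qed.

(* Closed form of the Hoggatt coefficient with n = a + b and k = b; for d = 1, a fibonomial. *)
Definition hoggatt_box a b d : K :=
  fibsuperfact (a + b + d) * fibsuperfact a * fibsuperfact b * fibsuperfact d
  / (fibsuperfact (a + d) * fibsuperfact (b + d) * fibsuperfact (a + b)).

Lemma hoggatt_box_neq0 a b d : hoggatt_box a b d != 0.
Proof. by rewrite /hoggatt_box mulf_neq0 ?invr_eq0 ?mulf_neq0 ?fibsuperfact_neq0. Qed.

Lemma hoggatt_box0l b d : hoggatt_box 0 b d = 1.
Proof.
rewrite /hoggatt_box !add0n fibsuperfact0.
by field; rewrite !fibsuperfact_neq0.
Qed.

Lemma hoggatt_box0r a d : hoggatt_box a 0 d = 1.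
Proof.
rewrite /hoggatt_box !addn0 !add0n fibsuperfact0.
by field; rewrite !fibsuperfact_neq0.
Qed.

Lemma hoggatt_box_d0 a b : hoggatt_box a b 0 = 1.
Proof.
rewrite /hoggatt_box !addn0 fibsuperfact0.
by field; rewrite !fibsuperfact_neq0.
Qed.

Lemma hoggatt_box_d1 a b :
  hoggatt_box a b 1 = fibfact (a + b) / (fibfact a * fibfact b).
Proof.
rewrite /hoggatt_box !addn1 !fibsuperfactS fibsuperfact0 fibfact0.
by field; rewrite !fibsuperfact_neq0 !fibfact_neq0.
Qed.

(** Relative to x^2, the superfactorials in both products cancel down to four Fibonacci factors over
    the common denominator [q]. The claim becomes Vajda's identity at a + 1, b + 1, d + 1. *)
Lemma hoggatt_box_rec a b d :
  hoggatt_box a.+1 b.+1 d.+2 * hoggatt_box a.+1 b.+1 d =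
  hoggatt_box a.+1 b.+1 d.+1 ^+ 2
  - (- t) ^+ d.+1 * (hoggatt_box a b.+2 d.+1 * hoggatt_box a.+2 b d.+1).
Proof.
have nz := (fibsuperfact_neq0, fibfact_neq0, f_neq0).
have := fib_vajda a.+1 b.+1 d.+1; set w := (- t) ^+ _ => V.
set x := hoggatt_box a.+1 b.+1 d.+1; set q := f (a.+1 + d.+1) * f (b.+1 + d.+1).
have -> : hoggatt_box a.+1 b.+1 d.+2 * hoggatt_box a.+1 b.+1 d =
    x ^+ 2 * (f (a.+1 + b.+1 + d.+1) * f d.+1) / q.
  rewrite /x /q /hoggatt_box !(addnS, addSn) !(fibsuperfactS, fibfactS).
  by field; rewrite !nz.
have -> : hoggatt_box a b.+2 d.+1 * hoggatt_box a.+2 b d.+1 =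
    x ^+ 2 * (f a.+1 * f b.+1) / q.
  rewrite /x /q /hoggatt_box !(addnS, addSn) !(fibsuperfactS, fibfactS).
  by field; rewrite !nz.
by rewrite -V -/q; field; rewrite /q !(addnS, addSn) mulf_neq0 ?nz.
Qed.

Lemma toeplitz_det_hoggatt (c : int -> K) n d a b : t != 0 ->
  (forall k : int, k < 0 -> c k = 0) ->
  (forall k : int, n%:Z < k -> c k = 0) ->
  (forall a b, (a + b)%N = n -> c b%:Z = hoggatt_box a b 1) ->
  (a + b)%N = n -> toeplitz_det (- t) c d b%:Z = hoggatt_box a b d.
Proof.
rewrite -oppr_eq0 => t0 cneg clarge cE.
(* The recurrence has order two in [d] and moves [k], so the induction carries two consecutive sizes
   and all [a], [b]. *)
suff: forall d a b, (a + b)%N = n ->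
    toeplitz_det (- t) c d b%:Z = hoggatt_box a b d /\
    toeplitz_det (- t) c d.+1 b%:Z = hoggatt_box a b d.+1.
  by move=> P /P -/(_ d) [].
move=> {a b}; elim=> [|{}d IH] a b abn.
  split; first by rewrite /toeplitz_det det_mx00 hoggatt_box_d0.
  rewrite /toeplitz_det det_mx11 mxE subrr -(cE a b abn) [_ ^ _]expr0z mul1r.
  by rewrite subr0 addr0.
have [IH0 IH1] := IH a b abn; split=> //.
have box0 := hoggatt_box_neq0 a b d.
apply: (mulIf box0); rewrite -{1}IH0 toeplitz_det_rec ?IH0 // IH1.
(* At an end, a = 0 or b = 0, one neighbouring determinant vanishes and all boxes equal 1. *)
case: a abn {IH0 IH1 box0} => [|a] abn.
  rewrite -abn add0n in clarge.
  by rewrite toeplitz_det_high // !hoggatt_box0l; ring.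
case: b abn => [|b] abn.
  by rewrite [0 - 1]sub0r toeplitz_det_low // !hoggatt_box0r; ring.
rewrite hoggatt_box_rec.
have -> : b.+1%:Z + 1 = b.+2%:Z by rewrite [in RHS]intS addrC.
have -> : b.+1%:Z - 1 = b%:Z by rewrite intS addrC addKr.
by rewrite (IH a b.+2 _).2 ?(IH a.+2 b _).2 // -abn ?addSn ?addnS.
Qed.

(** * Telescoping of the defining products, and a Pascal rule *)

Lemma prod_rev_interval (h : nat -> K) n k : (k <= n)%N ->
  (\prod_(j < k) h (n - j).-1) * \prod_(i < n - k) h i = \prod_(i < n) h i.
Proof.
elim: k => [|k IH] kn; first by rewrite big_ord0 mul1r subn0.
rewrite -(IH (ltnW kn)) big_ord_recr /= -mulrA; congr (_ * _).
by rewrite subnS; case: (n - k)%N (subn_gt0 k n) => [|m _]; rewrite ?kn // big_ord_recr mulrC.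
Qed.

Lemma prod_fib_ratio n k : (k <= n)%N ->
  \prod_(j < k) (f (n - j)%N / f (k - j)%N) = hoggatt_box (n - k) k 1.
Proof.
move=> kn; rewrite hoggatt_box_d1 subnK // prodf_div.
have E m : (k <= m)%N -> (\prod_(j < k) f (m - j)%N) * fibfact (m - k) = fibfact m.
  move=> km; rewrite -[RHS](prod_rev_interval (fun i => f i.+1) m k km); congr (_ * _).
  by apply: eq_bigr => j _; rewrite prednK // subn_gt0 (leq_trans _ km).
have := E k (leqnn k); rewrite subnn fibfact0 mulr1 => ->.
by rewrite -(E n kn); field; rewrite !fibfact_neq0.
Qed.

(** Numerator and denominator are the same product [E m], at m = n and m = k. Each telescopes to
    superfactorials, and the powers of [fibfact d] cancel. *)
Lemma prod_fibonomial_ratio n k d : (k <= n)%N ->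
  \prod_(j < k) (hoggatt_box (n - j).-1 d 1 / hoggatt_box (k - j).-1 d 1) =
  hoggatt_box (n - k) k d.
Proof.
move=> kn; pose h m i := fibfact (i + m).
have shift m : \prod_(i < m) h d i = fibsuperfact (m + d) / fibsuperfact d.
  elim: m => [|m IH]; first by rewrite big_ord0 divff // fibsuperfact_neq0.
  by rewrite big_ord_recr IH addSn fibsuperfactS /h /=; ring.
have E m : (k <= m)%N ->
  \prod_(j < k) hoggatt_box (m - j).-1 d 1 =
  fibsuperfact (m + d) * fibsuperfact (m - k)
  / (fibsuperfact (m - k + d) * fibsuperfact m * fibfact d ^+ k).
  move=> km; have := prod_rev_interval (h d) m k km.
  rewrite !shift => E1; have := prod_rev_interval fibfact m k km.
  rewrite -!/(fibsuperfact _) => E2.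
  under eq_bigr do rewrite hoggatt_box_d1.
  rewrite prodf_div big_split prodr_const card_ord /=.
  have nz1 : \prod_(j < k) fibfact (m - j).-1 != 0 by apply/prodf_neq0 => j _; exact: fibfact_neq0.
  rewrite -E2.
  have -> : fibsuperfact (m + d) =
      (\prod_(j < k) fibfact ((m - j).-1 + d)) * fibsuperfact (m - k + d).
    by apply: (mulIf (invr_neq0 (fibsuperfact_neq0 d))); rewrite -E1; ring.
  by field; rewrite ?expf_neq0 ?nz1 ?fibfact_neq0 ?fibsuperfact_neq0.
rewrite prodf_div !E // subnn add0n /hoggatt_box subnK // fibsuperfact0.
by field; rewrite ?expf_neq0 ?fibfact_neq0 ?fibsuperfact_neq0.
Qed.

(** This is the addition formula for f(a + b + 2) times a common quotient of factorials. Its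
    coefficients are polynomials in s and t, so it propagates integrality of fibonomials. *)
Lemma hoggatt_box_pascal a b :
  hoggatt_box a.+1 b.+1 1 = f b.+2 * hoggatt_box a b.+1 1 + t * f a * hoggatt_box a.+1 b 1.
Proof.
rewrite !hoggatt_box_d1 !(addnS, addSn) !fibfactS.
have -> : f (a + b).+2 = f b.+2 * f a.+1 + t * f b.+1 * f a.
  by rewrite -addnS addnC fib_add mulrA.
by field; rewrite ?f_neq0 ?fibfact_neq0.
Qed.

End FibonacciField.

(** * Specialization to the fraction field of Z[s,t], and polynomiality *)

Definition fibQ n : Qst := tofrac (fibpoly n).

Lemma fibQ_neq0 n : fibQ n.+1 != 0.
Proof.
rewrite /fibQ tofrac_eq0; apply: contraTneq (fibpoly_at1_gt0 n) => ->.
by rewrite meval0 ltxx.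
Qed.

Lemma fibQ_rec n : fibQ n.+2 = tofrac s * fibQ n.+1 + tofrac t * fibQ n.
Proof. by rewrite /fibQ -!tofracM -tofracD. Qed.

Lemma tofrac_t_neq0 : tofrac t != 0 :> Qst.
Proof.
rewrite tofrac_eq0; apply/eqP => /(congr1 (meval (fun=> 1))).
by rewrite mevalXU meval0.
Qed.

Local Notation box := (hoggatt_box Qst fibQ).

Lemma fibonomial_box n k : (k <= n)%N -> fibonomial n k%:Z = box (n - k)%N k 1.
Proof.
move=> kn; rewrite /fibonomial lez_nat kn /=.
exact: (prod_fib_ratio Qst fibQ fibQ_neq0).
Qed.

Lemma fibonomial_neg n (k : int) : k < 0 -> fibonomial n k = 0.
Proof. by rewrite /fibonomial ltNge => /negPf ->. Qed.

Lemma fibonomial_gt n (k : int) : n%:Z < k -> fibonomial n k = 0.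
Proof. by rewrite /fibonomial ltNge => /negPf ->; rewrite andbF. Qed.

Lemma hoggatt_box1_poly a b : exists p : Zst, box a b 1 = tofrac p.
Proof.
elim: a b => [|a IHa] b.
  by exists 1; rewrite hoggatt_box0l ?tofrac1 //; exact: fibQ_neq0.
elim: b => [|b [q IHb]].
  by exists 1; rewrite hoggatt_box0r ?tofrac1 //; exact: fibQ_neq0.
have [p IHp] := IHa b.+1.
exists (fibpoly b.+2 * p + t * fibpoly a * q).
rewrite (hoggatt_box_pascal Qst (tofrac s) (tofrac t)) ?IHp ?IHb.
- by rewrite /fibQ !(tofracD, tofracM).
- exact: tofrac0.
- exact: tofrac1.
- exact: fibQ_rec.
- exact: fibQ_neq0.
Qed.

Lemma fibonomial_poly n (k : int) : exists p : Zst, fibonomial n k = tofrac p.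
Proof.
case: (ltrP k 0) => [/fibonomial_neg->|k0]; first by exists 0; rewrite tofrac0.
case: (ltrP n%:Z k) => [/fibonomial_gt->|]; first by exists 0; rewrite tofrac0.
case: k k0 => // k _; rewrite lez_nat => kn.
by rewrite fibonomial_box //; exact: hoggatt_box1_poly.
Qed.

Lemma hoggatt_closed d n k : (0 < d)%N -> (k <= n)%N -> hoggatt d n k = box (n - k)%N k d.
Proof.
move=> d0 kn.
(* Since j < m, no subtraction truncates, and the complement of [d] is m - j - 1. *)
have E m j : (j < m)%N -> fibonomial (m - j + d - 1) d%:Z = box (m - j).-1 d 1.
  move=> jm; rewrite fibonomial_box; last by lia.
  by congr (box _ _ _); lia.
rewrite -prod_fibonomial_ratio //; last exact: fibQ_neq0.
by apply: eq_bigr => j _; rewrite !E // (leq_trans _ kn).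
Qed.

(** The Leibniz expansion uses only sums, products and signs, under which the image of [tofrac] is
    closed. *)
Lemma det_in_tofrac_image n (A : 'M[Qst]_n) :
  (forall i j, exists p : Zst, A i j = tofrac p) -> exists p : Zst, \det A = tofrac p.
Proof.
move=> HA; apply: (big_ind (fun x => exists p : Zst, x = tofrac p)) => [|x y [p ->] [q ->]|w _].
- by exists 0; rewrite tofrac0.
- by exists (p + q); rewrite tofracD.
have [p ->] : exists p : Zst, \prod_i A i (w i) = tofrac p.
  apply: (big_ind (fun x => exists p : Zst, x = tofrac p)) => [|x y [p ->] [q ->]|i _]; last exact: HA.
  - by exists 1; rewrite tofrac1.
  - by exists (p * q); rewrite tofracM.
by exists ((-1) ^+ w * p); rewrite tofracM tofracXn tofracN tofrac1.
Qed.

Theorem theorem15 (d n k : nat) (hd : (0 < d)%N) (hkn : (k <= n)%N) :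
  \det (\matrix_(i < d, j < d)
          ((- tofrac t) ^ binz2 (i%:Z - j%:Z)
           * fibonomial n (k%:Z - j%:Z + i%:Z))) = hoggatt d n k
  /\ exists p : Zst, hoggatt d n k = tofrac p.
Proof.
have E : \det (\matrix_(i < d, j < d)
          ((- tofrac t) ^ binz2 (i%:Z - j%:Z)
           * fibonomial n (k%:Z - j%:Z + i%:Z))) = hoggatt d n k.
  rewrite hoggatt_closed //.
  apply: (toeplitz_det_hoggatt Qst (tofrac s) (tofrac t) fibQ
    _ _ _ _ (fibonomial n) n).
  - exact: tofrac0.
  - exact: tofrac1.
  - exact: fibQ_rec.
  - exact: fibQ_neq0.
  - exact: tofrac_t_neq0.
  - exact: fibonomial_neg.
  - exact: fibonomial_gt.
  - by move=> a b <-; rewrite fibonomial_box ?leq_addl // addnK.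
  - exact: subnK.
split=> //; rewrite -E; apply: det_in_tofrac_image => i j; rewrite mxE.
have [p ->] := fibonomial_poly n (k%:Z - j%:Z + i%:Z).
(* The exponent is nonnegative even for i < j, so no inverse of -t occurs. *)
have := binz2_ge0 (i%:Z - j%:Z); case: (binz2 _) => // m _.
by exists ((- t) ^+ m * p); rewrite tofracM tofracXn tofracN.
Qed.
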